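(* For any integer $e > 130$ and any integer $n \ge e + 2 + 13\sqrt{e}$, the graph $\mathcal{V}_{n,e}$ is the unique graph (up to isomorphism) that attains the maximum spectral radius on $\mathcal{C}_{n,e}$.
   Context: All graphs are undirected, finite and simple. The spectral radius of a graph is the largest modulus of an eigenvalue of its adjacency matrix. $G_1 \lor G_2$ and $G_1 + G_2$ denote the join and the disjoint union of graphs; $0K_1$ is the empty graph on no vertices, neutral for both operations. $\mathcal{C}_{n,e}$ is the set of connected graphs with $n$ vertices and $n-1+e$ edges. For $n \ge e+2$, the graph $\mathcal{V}_{n,e} \in \mathcal{C}_{n,e}$ is $\mathcal{V}_{n,e} = (K_{1,e} + (n-e-2)K_1) \lor K_1$. *)

(* Defs.v *)
From HB Require Import structures.
From mathcomp Require Import all_boot all_order all_algebra.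
From mathcomp Require Import boolp classical_sets reals.
From mathcomp Require Import complex.

Set Implicit Arguments.
Unset Strict Implicit.
Unset Printing Implicit Defensive.

Import Order.TTheory GRing.Theory Num.Theory.

Local Open Scope ring_scope.

Record sgraph := SGraph {
  vertex :> finType;
  adj : rel vertex;
  adj_sym : symmetric adj;
  adj_irr : irreflexive adj }.

Definition isomorphic (G H : sgraph) : Prop :=
  exists2 f : G -> H, bijective f & forall x y, adj (f x) (f y) = adj x y.

Definition edges (G : sgraph) : {set {set G}} :=
  [set A : {set G} | [exists x : G, exists y : G, adj x y && (A == [set x; y]%SET)]].

Definition connected (G : sgraph) : Prop :=
  (0 < #|G|)%N /\ forall x y : G, connect (@adj G) x y.

(* edgeless m is the graph m K_1; in particular edgeless 0 is 0 K_1. *)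
Definition edgeless (m : nat) : sgraph :=
  @SGraph 'I_m (fun _ _ => false) (fun _ _ => erefl) (fun _ => erefl).

Section UnionJoin.
Variables (G H : sgraph) (cross : bool).

Definition sum_adj : rel (G + H)%type := fun u v =>
  match u, v with
  | inl x, inl y => adj x y
  | inr x, inr y => adj x y
  | _, _ => cross
  end.

Lemma sum_adj_sym : symmetric sum_adj.
Proof. by move=> [x|x] [y|y] //=; rewrite adj_sym. Qed.

Lemma sum_adj_irr : irreflexive sum_adj.
Proof. by move=> [x|x] /=; rewrite adj_irr. Qed.

End UnionJoin.

Definition disjoint_union (G H : sgraph) : sgraph :=
  SGraph (@sum_adj_sym G H false) (@sum_adj_irr G H false).

Definition join (G H : sgraph) : sgraph :=
  SGraph (@sum_adj_sym G H true) (@sum_adj_irr G H true).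

Definition complete_bipartite (p q : nat) : sgraph :=
  join (edgeless p) (edgeless q).

(* C_(n,e); a connected graph is nonempty, so n - 1 is not truncated. *)
Definition graph_class (n e : nat) (G : sgraph) : Prop :=
  [/\ connected G, #|G| = n & #|edges G| = (n - 1 + e)%N].

(* The subtraction is truncated: this is V_(n,e) only when e + 2 <= n. *)
Definition graphV (n e : nat) : sgraph :=
  join (disjoint_union (complete_bipartite 1 e) (edgeless (n - e - 2)))
       (edgeless 1).

Definition adjacency (K : nzRingType) (G : sgraph) : 'M[K]_#|G| :=
  \matrix_(i, j) (adj (enum_val i) (enum_val j))%:R.

(* The set is finite, and nonempty as soon as G has a vertex, so that sup is
   then a maximum: see spectral_radius_max. *)
Definition spectral_radius (R : realType) (G : sgraph) : R :=
  sup [set r : R | exists2 z : R[i],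
         eigenvalue (adjacency R[i] G) z & r = ComplexField.Normc.normc z]%classic.

Definition maximizes_spectral_radius (R : realType) (n e : nat) (G : sgraph)
    : Prop :=
  graph_class n e G /\
  forall H : sgraph, graph_class n e H ->
    spectral_radius R H <= spectral_radius R G.

Lemma spectral_radius_max (R : realType) (G : sgraph) : (0 < #|G|)%N ->
  (exists2 z : R[i], eigenvalue (adjacency R[i] G) z &
     spectral_radius R G = ComplexField.Normc.normc z) /\
  (forall z : R[i], eigenvalue (adjacency R[i] G) z ->
     ComplexField.Normc.normc z <= spectral_radius R G).
Proof.
move=> G0; set A := adjacency _ _; set f := @ComplexField.Normc.normc R.
have [s] := closed_field_poly_normal (char_poly A).
rewrite (monicP (char_poly_monic A)) scale1r => sE.
have eigE z : eigenvalue A z = (z \in s).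
  by rewrite eigenvalue_root_char sE root_prod_XsubC.
have [z0 zs zmax] : exists2 z0, z0 \in s & forall z, z \in s -> f z <= f z0.
  have : s != [::].
    apply: contraTneq G0 => s0; have := size_char_poly A.
    by rewrite sE s0 big_nil size_poly1 => -[<-].
  elim: s {sE eigE} => // a [|b s] IH _.
    by exists a; rewrite ?mem_head // => z; rewrite inE => /eqP ->.
  have [//|c cs cmax] := IH; have [ca|ac] := leP (f c) (f a).
    exists a; rewrite ?mem_head // => z; rewrite in_cons.
    by case/predU1P => [-> //|/cmax/le_trans]; exact.
  exists c; first by rewrite in_cons cs orbT.
  by move=> z; rewrite in_cons => /predU1P[->|/cmax //]; exact: ltW.
suff supE : spectral_radius R G = f z0.
  by split=> [|z]; [exists z0; rewrite ?eigE|rewrite eigE supE; exact: zmax].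
apply/eqP; rewrite eq_le; apply/andP; split.
  apply: ge_sup; first by exists (f z0), z0; rewrite ?eigE.
  by move=> _ [z] + ->; rewrite eigE; exact: zmax.
apply: ub_le_sup; last by exists z0; rewrite ?eigE.
by exists (f z0) => _ [z] + ->; rewrite eigE; exact: zmax.
Qed.

(* Main.v *)
Require Import Defs.
From mathcomp Require Import all_boot all_order all_algebra.
From mathcomp Require Import boolp reals complex ring lra zify.

(** The proof has two halves.

    Structure of a maximizer.  The adjacency matrix is symmetric, so the
    spectral radius [L] of a graph is the maximum of its Rayleigh quotient
    ([rayleigh]), and for a connected graph it is attained at a positive vector
    [x] ([perron]).  Replacing an edge [b w] by an edge [a w] with [x b <= x a]
    increases the radius ([spectral_radius_rotated]), so no such rotation may
    leave a maximizer connected.  This forces a vertex [v] adjacent to all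
    others, and a second vertex [u] adjacent to every other vertex that has a
    neighbour other than [v] ([maximal_hub_pair]).  If the set [U] of the [d]
    common neighbours of [v] and [u] spans [s] edges, then counting edges gives
    [d + s = e], and [s = 0] means that the graph is the expected one.

    Why [s = 0].  Put [delta = n - e - 2].  Summing the eigenvalue equation over
    [U] leaves two linear equations in [x u] and [x v], which say that
    [(L^2 - q) (L^2 - q - delta - s) = (L + q)^2], where [q = d + P] and
    [P (x u + x v)] is the sum of [x w] over the ordered pairs [b w] of adjacent
    vertices of [U].  The expected graph has [q = e] and [s = 0].  A graph with
    [s > 0] can only compete if [P] nearly compensates the loss of [s] edges at [u]; but expanding
    the walks twice ([walk_sum_bound]) and bounding the sum of the squares of the
    degrees in [U] ([degree_square_sum_le]) gives
    [P <= s (2 L + d + sqrt (2 e)) / (L^2 - 2 s)], which is too small.  The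
    critical case is that of a clique, where [d] is about [sqrt (2 e)]: there
    [L^2 - 2 s] is small as well, and what saves the inequality is
    [L^2 >= 2 e + L + delta / 2] together with [delta >= 13 sqrt e].  The resulting
    polynomial inequality is [clique_star_inequality], and [star_dominates] draws
    the contradiction.

    Finally a maximizer exists because there are finitely many graphs on [n]
    vertices; it is isomorphic to the expected graph, which is thus a maximizer
    too. *)

Set Implicit Arguments.
Unset Strict Implicit.
Unset Printing Implicit Defensive.

Import Order.TTheory GRing.Theory Num.Theory.
Local Open Scope ring_scope.

(** * Rayleigh quotients and Perron vectors *)

Local Open Scope sesquilinear_scope.

(** In an orthonormal eigenbasis, with [y] the coordinates of [w], the gap between
    the two sides is the sum of the nonnegative terms [(r - d k) * `|y k| ^+ 2];
    when it is zero, [w] lives on the eigenvectors of eigenvalue [r]. *)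
Lemma hermitian_rayleigh (C : numClosedFieldType) (n : nat) (A : 'M[C]_n) (r : C) :
    A \is hermsymmx -> (forall z, eigenvalue A z -> `|z| <= r) ->
  forall w : 'rV[C]_n,
    (w *m A *m w ^t*) 0 0 <= r * (w *m w ^t*) 0 0 /\
    ((w *m A *m w ^t*) 0 0 = r * (w *m w ^t*) 0 0 -> w *m A = r *: w).
Proof.
move=> hermA max_r w.
have /orthomx_spectralP spA := hermitian_normalmx hermA.
set P := spectralmx A in spA; set d := spectral_diag A in spA.
have unitP : P \is unitarymx := spectral_unitarymx A.
have unitP' := unitarymx_unit unitP.
have d_le k : d 0 k <= r.
  have /mxOverP/(_ 0 k)/real_ler_norm := hermitian_spectral_diag_real hermA.
  move=> /le_trans; apply; apply: max_r; apply/eigenvalueP; exists (delta_mx 0 k *m P).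
    rewrite [X in _ *m X]spA !mulmxA mulmxK // scalemxAl; congr (_ *m _).
    by apply/rowP => j; rewrite mul_mx_diag !mxE mulrC eqxx /=;
       case: eqP => [->|]; rewrite ?mulr0.
  apply/eqP => /(congr1 (mulmx^~ (invmx P))); rewrite mulmxK // mul0mx.
  by move/rowP/(_ k); rewrite !mxE !eqxx => /eqP; rewrite oner_eq0.
set y := w *m invmx P.
have wE : w = y *m P by rewrite mulmxKV.
have PPt : P *m P ^t* = 1%:M by apply/unitarymxP.
have wAE : w *m A = y *m diag_mx d *m P.
  by rewrite wE [X in _ *m X]spA !mulmxA mulmxK.
have wt : w ^t* = P ^t* *m y ^t* by rewrite wE trmx_mul map_mxM.
have normE : r * (w *m w ^t*) 0 0 - (w *m A *m w ^t*) 0 0 =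
    \sum_k (r - d 0 k) * `|y 0 k| ^+ 2.
  rewrite wAE wt {1}wE !mulmxA -[y *m P *m _]mulmxA PPt mulmx1.
  rewrite -[y *m _ *m P *m _]mulmxA PPt mulmx1 !mxE mulr_sumr -sumrB.
  apply: eq_bigr => k _; rewrite mul_mx_diag !mxE normCK; ring.
have ge0 k : 0 <= (r - d 0 k) * `|y 0 k| ^+ 2.
  by rewrite mulr_ge0 ?subr_ge0 ?exprn_ge0.
split; first by rewrite -subr_ge0 normE sumr_ge0.
move/eqP; rewrite eq_sym -subr_eq0 normE psumr_eq0 // => /allP yP.
rewrite wAE wE scalemxAl; congr (_ *m _); apply/rowP => k.
have /= := yP k (mem_index_enum k).
rewrite mul_mx_diag [RHS]mxE [LHS]mxE.
rewrite mulf_eq0 subr_eq0 sqrf_eq0 normr_eq0 => /orP[/eqP ->|/eqP ->].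
  by rewrite mulrC.
by rewrite mul0r mulr0.
Qed.

Definition neighbor_sum (R : nmodType) (G : sgraph) (x : G -> R) (v : G) : R :=
  \sum_(w | adj v w) x w.

Section Spectral.
Variables (R : realType) (G : sgraph).
Local Notation C := R[i].
Local Notation A := (adjacency C G).
Implicit Type x : G -> R.

Lemma sum_enum_val (V : nmodType) (F : G -> V) :
  \sum_v F v = \sum_(i < #|G|) F (enum_val i).
Proof. by apply: reindex; apply/onW_bij/enum_val_bij. Qed.

Lemma mulmx_adjacency (w : 'rV[C]_#|G|) j :
  (w *m A) 0 j = neighbor_sum (fun v => w 0 (enum_rank v)) (enum_val j).
Proof.
rewrite mxE /neighbor_sum [RHS]big_mkcond sum_enum_val.
apply: eq_bigr => i _; rewrite mxE enum_valK adj_sym.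
by case: adj; rewrite ?mulr1 ?mulr0.
Qed.

Lemma adjacency_hermitian : A \is hermsymmx.
Proof.
apply/is_hermitianmxP; rewrite expr0 scale1r; apply/matrixP => i j.
by rewrite !mxE adj_sym rmorph_nat.
Qed.

Lemma eigenvalue_le_spectral_radius z : (0 < #|G|)%N -> eigenvalue A z ->
  `|z| <= (spectral_radius R G)%:C%C.
Proof.
move=> G0 eig_z; have [_ /(_ z eig_z)] := spectral_radius_max R G0.
by rewrite -lecR; case: z {eig_z} => a b; rewrite normc_def.
Qed.

(** The variational bound for real vectors, with its equality case; the
    equality case is what makes rotations strictly increase the radius. *)
Lemma rayleigh x : (0 < #|G|)%N ->
  let r := spectral_radius R G in
  \sum_v x v * neighbor_sum x v <= r * \sum_v x v ^+ 2 /\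
  (\sum_v x v * neighbor_sum x v = r * \sum_v x v ^+ 2 ->
   forall v, neighbor_sum x v = r * x v).
Proof.
move=> G0 r; pose w : 'rV[C]_#|G| := \row_i (x (enum_val i))%:C%C.
have wA j : (w *m A) 0 j = (neighbor_sum x (enum_val j))%:C%C.
  rewrite mulmx_adjacency /neighbor_sum rmorph_sum; apply: eq_bigr => v _ /=.
  by rewrite mxE enum_rankK.
have conjR (y : R) : (y%:C%C)^* = y%:C%C :> C.
  by apply/CrealP/complex_realP; exists y.
have formE : (w *m A *m w ^t*) 0 0 = (\sum_v x v * neighbor_sum x v)%:C%C.
  rewrite mxE sum_enum_val rmorph_sum; apply: eq_bigr => i _.
  by rewrite wA !mxE [_^*]conjR /= -rmorphM mulrC.
have normE : (w *m w ^t*) 0 0 = (\sum_v x v ^+ 2)%:C%C.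
  rewrite mxE sum_enum_val rmorph_sum; apply: eq_bigr => i _.
  by rewrite !mxE [_^*]conjR /= -rmorphM expr2.
have [] := hermitian_rayleigh adjacency_hermitian
  (fun z => eigenvalue_le_spectral_radius G0 (z := z)) w.
rewrite formE normE -rmorphM lecR => le_r eq_r; split=> // /(congr1 (real_complex R)).
move/eq_r => wAr v; have /rowP/(_ (enum_rank v)) := wAr.
by rewrite wA !mxE enum_rankK -rmorphM => /complexI.
Qed.

End Spectral.

Local Close Scope sesquilinear_scope.

Section Perron.
Variables (R : realType).

(** The moduli [x] of the entries of an eigenvector whose eigenvalue has modulus
    [r] satisfy [r * x v <= neighbor_sum x v] by the triangle inequality, so the
    Rayleigh quotient of [x] is at least, hence exactly, [r]. *)
Lemma perron_nonneg (G : sgraph) : (0 < #|G|)%N ->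
  exists2 x : G -> R, (forall v, 0 <= x v) /\ (exists v, x v != 0) &
    forall v, neighbor_sum x v = spectral_radius R G * x v.
Proof.
move=> G0; set r := spectral_radius R G.
have [[z /eigenvalueP[w wA w0] rE] _] := spectral_radius_max R G0.
pose f := @ComplexField.Normc.normc R.
have fE (u : R[i]) : `|u| = (f u)%:C%C by case: u => a b; rewrite normc_def.
pose x (v : G) := f (w 0 (enum_rank v)).
have xC v : (x v)%:C%C = `|w 0 (enum_rank v)| by rewrite fE.
have rC : r%:C%C = `|z| by rewrite fE /f -rE.
have x0 v : 0 <= x v by rewrite -ler0c xC.
have sub v : r * x v <= neighbor_sum x v.
  have /rowP/(_ (enum_rank v)) := wA; rewrite mulmx_adjacency mxE enum_rankK.
  move/(congr1 Num.norm) => e; rewrite -lecR rmorphM [_ r]rC [_ (x v)]xC -normrM -e.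
  rewrite rmorph_sum; under eq_bigr do rewrite [_ (x _)]xC.
  exact: ler_norm_sum.
exists x.
  split=> //; have /rV0Pn[i wi] := w0; exists (enum_val i).
  rewrite /x enum_valK; apply: contra wi => /eqP fi.
  by rewrite -normr_eq0 fE fi.
have [le_r eq_r] := rayleigh x G0; apply: eq_r; apply/eqP.
rewrite eq_le le_r mulr_sumr; apply: ler_sum => v _.
by rewrite expr2 mulrCA ler_wpM2l.
Qed.

(** A zero entry of the nonnegative eigenvector forces its neighbours to be zero,
    and connectedness spreads this to the whole graph. *)
Lemma perron (G : sgraph) : connected G ->
  exists2 x : G -> R, (forall v, 0 < x v) &
    forall v, neighbor_sum x v = spectral_radius R G * x v.
Proof.
move=> [G0 conn]; have [x [x0 [u xu]] xE] := perron_nonneg G0.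
exists x => // v; rewrite lt_def x0 andbT.
have nb a b : adj a b -> x b != 0 -> x a != 0.
  move=> ab; apply: contra => /eqP xa; have /eqP := xE a.
  rewrite xa mulr0 psumr_eq0 // => /allP/(_ b (mem_index_enum _)).
  by rewrite ab.
have /connectP[p pth ulast] := conn v u; rewrite {}ulast in xu.
elim: p v pth xu => //= b p IH v /andP[vb /IH{}IH] /IH; exact: nb.
Qed.

(** The Perron vector of [G], transported to [H], is an eigenvector there. *)
Lemma spectral_radius_isomorphic (G H : sgraph) :
  connected G -> (0 < #|H|)%N -> isomorphic G H ->
  spectral_radius R G <= spectral_radius R H.
Proof.
move=> connG H0 [f [g fK gK] fadj].
have [x x0 xE] := perron connG.
have [] := rayleigh (x \o g) H0.
have nbE v : neighbor_sum (x \o g) v = spectral_radius R G * x (g v).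
  rewrite -xE /neighbor_sum (reindex f) /=; last exact/onW_bij/(Bijective fK gK).
  by apply: eq_big => [w|w _]; rewrite ?fK // -[in RHS]fadj gK.
under eq_bigr do rewrite nbE mulrCA -expr2.
rewrite -mulr_sumr => + _; rewrite ler_pM2r //.
have /card_gt0P[v _] := H0; rewrite (bigD1 v) //=.
by rewrite ltr_wpDr ?exprn_gt0 // sumr_ge0 // => *; rewrite sqr_ge0.
Qed.

End Perron.

(** * Counting edges *)

(** Each edge is the set of ends of exactly two ordered pairs of adjacent
    vertices. *)
Lemma handshake (G : sgraph) : (\sum_(v : G) #|adj v| = 2 * #|edges G|)%N.
Proof.
pose D := [set p : G * G | adj p.1 p.2].
pose ends (p : G * G) := [set p.1; p.2].
have -> : (\sum_(v : G) #|adj v| = \sum_(p in D) 1)%N.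
  rewrite [RHS](eq_bigl (fun p => adj p.1 p.2)); last by move=> p; rewrite inE.
  rewrite -(pair_big_dep xpredT (@adj G) (fun _ _ => 1%N)) /=.
  by apply: eq_bigr => v _; rewrite sum1_card.
rewrite (partition_big ends [in edges G]) /=; last first.
  move=> [u v]; rewrite !inE /= => uv; apply/existsP; exists u.
  by apply/existsP; exists v; rewrite uv eqxx.
rewrite mulnC -sum_nat_const; apply: eq_bigr => A.
rewrite inE => /existsP[u /existsP[v /andP[uv /eqP ->]]].
have neq_uv : u != v by apply: contraTneq uv => ->; rewrite adj_irr.
have /esym card_uv : #|[set (u, v); (v, u)]| = 2%N.
  by rewrite cards2 xpair_eqE (negPf neq_uv).
rewrite sum1_card card_uv; apply: eq_card => -[u' v']; rewrite !inE /= !xpair_eqE.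
apply/andP/orP => [[uv' /eqP e]|[/andP[/eqP -> /eqP ->]|/andP[/eqP -> /eqP ->]]].
- have neq' : u' != v' by apply: contraTneq uv' => ->; rewrite inE /= adj_irr.
  have := set21 u' v'; have := set22 u' v'; rewrite [[set _; _]]e !inE.
  by move=> /orP[]/eqP ev /orP[]/eqP eu; apply/orP; move: neq';
     rewrite eu ev ?eqxx ?orbT.
- by rewrite inE /= uv eqxx.
- by rewrite inE /= adj_sym uv /ends /= setUC eqxx.
Qed.

(** * Rotating an edge *)

Section Rotation.
Variables (G : sgraph) (a b w : G).

Definition is_pair (p q u v : G) := (u == p) && (v == q) || (u == q) && (v == p).

(** The edge [b w] is replaced by [a w]; the test [a != w] makes the relation
    irreflexive whatever the parameters are. *)
Definition rotated_adj : rel G := fun u v =>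
  (a != w) && is_pair a w u v || adj u v && ~~ is_pair b w u v.

Lemma is_pair_sym p q u v : is_pair p q u v = is_pair p q v u.
Proof. by rewrite /is_pair orbC andbC [(v == q) && _]andbC. Qed.

Lemma rotated_adj_sym : symmetric rotated_adj.
Proof. by move=> u v; rewrite /rotated_adj !(is_pair_sym _ _ u) adj_sym. Qed.

Lemma rotated_adj_irr : irreflexive rotated_adj.
Proof.
move=> u; rewrite /rotated_adj adj_irr orbF; apply/andP => -[/eqP neq].
by rewrite /is_pair => /orP[]/andP[/eqP e1 /eqP e2]; apply: neq; rewrite -e1 -e2.
Qed.

Definition rotated : sgraph := SGraph rotated_adj_sym rotated_adj_irr.

Lemma rotated_kept (y z : G) : adj y z -> ~~ is_pair b w y z -> @adj rotated y z.
Proof. by rewrite /= /rotated_adj => -> ->; rewrite orbT. Qed.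

Lemma rotated_new : a != w -> @adj rotated a w.
Proof. by rewrite /= /rotated_adj /is_pair !eqxx => ->. Qed.

Hypotheses (adj_bw : adj b w) (nadj_aw : ~~ adj a w) (neq_aw : a != w)
  (neq_ab : a != b).

Lemma neighbor_sum_rotated (R : nzRingType) (x : G -> R) (v : G) :
  @neighbor_sum R rotated x v =
  neighbor_sum x v + (v == w)%:R * (x a - x b) + ((v == a)%:R - (v == b)%:R) * x w.
Proof.
have neq_bw : b != w by apply: contraTneq adj_bw => ->; rewrite adj_irr.
have sumE (c u : G) : \sum_z (z == u)%:R * ((v == c)%:R * x z) = (v == c)%:R * x u.
  rewrite (bigD1 u) //= eqxx mul1r big1 ?addr0 // => z /negPf ->.
  by rewrite mul0r.
rewrite mulrBr mulrBl -!(sumE w) -(sumE a) -(sumE b) /neighbor_sum.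
rewrite [LHS]big_mkcond [X in _ = X + _ + _]big_mkcond /=.
rewrite -!sumrB -!big_split /=; apply: eq_bigr => z _.
rewrite /rotated_adj /is_pair neq_aw /=.
have /implyP adj1 : (v == b) && (z == w) ==> @adj G v z.
  by apply/implyP => /andP[/eqP -> /eqP ->].
have /implyP adj2 : (v == w) && (z == b) ==> @adj G v z.
  by apply/implyP => /andP[/eqP -> /eqP ->]; rewrite adj_sym.
have /implyP nadj1 : (v == a) && (z == w) ==> ~~ @adj G v z.
  by apply/implyP => /andP[/eqP -> /eqP ->].
have /implyP nadj2 : (v == w) && (z == a) ==> ~~ @adj G v z.
  by apply/implyP => /andP[/eqP -> /eqP ->]; rewrite adj_sym.
have distinct u : [&& ~~ ((u == a) && (u == b)), ~~ ((u == a) && (u == w))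
    & ~~ ((u == b) && (u == w))].
  by case: eqVneq => [->|_]; rewrite /= ?neq_ab ?neq_aw //; case: eqVneq => // ->.
(* The identity now only depends on the truth values of the comparisons of [v]
   and [z] with [a], [b], [w] and of [adj v z]. *)
have := distinct v; have := distinct z; move: adj1 adj2 nadj1 nadj2.
case: (v == a); case: (v == b); case: (v == w) => //=;
  case: (z == a); case: (z == b); case: (z == w) => //= + + + + _ _;
  case: (@adj G v z) => //= a1 a2 a3 a4;
  rewrite ?mul1r ?mul0r ?subr0 ?sub0r ?addr0 ?add0r ?addrN //;
  by [case: (a1 isT)|case: (a2 isT)|case: (a3 isT)|case: (a4 isT)].
Qed.

(** Summed over [v], the formula of [neighbor_sum_rotated] for the constant vector
    shows that the total degree is preserved. *)
Lemma card_edges_rotated : #|edges rotated| = #|edges G|.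
Proof.
apply/eqP; rewrite -(eqn_pmul2l (isT : 0 < 2)%N) -!handshake; apply/eqP.
have degE (H : sgraph) :
    (\sum_(v : H) #|adj v|)%N%:R = \sum_v @neighbor_sum int H (fun=> 1) v.
  by rewrite natr_sum; apply: eq_bigr => v _; rewrite /neighbor_sum sumr_const.
have sum1 (u : G) : \sum_v (v == u)%:R = 1 :> int.
  by rewrite (bigD1 u) //= eqxx big1 ?addr0 // => v /negPf ->.
apply/eqP; rewrite -(eqr_nat int) !degE; apply/eqP.
under eq_bigr do rewrite (neighbor_sum_rotated (fun=> 1)) subrr mulr0 addr0 mulr1.
by rewrite big_split sumrB !sum1 subrr /= addr0.
Qed.

(** Only the edge [b w] is lost, so reconnecting its two ends is enough. *)
Lemma rotated_connected : connected G -> connect (@adj rotated) b w ->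
  connected rotated.
Proof.
move=> [G0 conn] conn_bw; split=> // u v; have := conn u v.
apply: connect_sub => {u v} u v uv.
have [|not_bw] := boolP (is_pair b w u v).
  have sym := @sym_connect_sym rotated _ rotated_adj_sym.
  by case/orP=> /andP[/eqP -> /eqP ->] //; rewrite sym.
exact/connect1/rotated_kept.
Qed.

(** The quadratic form of the Perron vector grows by [2 * x w * (x a - x b)], so
    the radius cannot drop.  If it did not grow, [x] would also be an eigenvector
    of the rotated graph, for an eigenvalue that is not larger; but the sum at [a]
    has strictly increased. *)
Lemma spectral_radius_rotated (R : realType) (x : G -> R) :
    (forall v, 0 < x v) ->
    (forall v, neighbor_sum x v = spectral_radius R G * x v) -> x b <= x a ->
  spectral_radius R G < spectral_radius R rotated.
Proof.
move=> x0 xE le_ba; set r := spectral_radius R G; rewrite ltNge; apply/negP => le_r.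
have [|max_x eq_x] := @rayleigh R rotated x; first by apply/card_gt0P; exists a.
set r' := spectral_radius R rotated in le_r max_x eq_x.
have pick (f : G -> R) (c : G) : \sum_v f v * (v == c)%:R = f c.
  rewrite (bigD1 c) //= eqxx mulr1 big1 ?addr0 // => v /negPf ->.
  by rewrite mulr0.
have formE : \sum_v x v * @neighbor_sum R rotated x v =
    r * (\sum_(v : G) x v ^+ 2) + 2 * x w * (x a - x b).
  transitivity (\sum_v (r * x v ^+ 2 + (x a - x b) * (x v * (v == w)%:R) +
      x w * (x v * (v == a)%:R) - x w * (x v * (v == b)%:R))).
    by apply: eq_bigr => v _; rewrite neighbor_sum_rotated xE -/r; ring.
  by rewrite sumrB !big_split -!mulr_sumr !pick /=; ring.
have gain : 0 <= 2 * x w * (x a - x b) by rewrite mulr_ge0 ?mulr_ge0 ?subr_ge0 // ltW.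
have norm0 : 0 <= \sum_(v : G) x v ^+ 2 by apply: sumr_ge0 => v _; apply: sqr_ge0.
have le_norm := ler_wpM2r norm0 le_r.
have := eq_x _ a; rewrite formE neighbor_sum_rotated xE eqxx.
rewrite (negPf neq_aw) (negPf neq_ab) -/r => eq_a.
clearbody r r'.
have : r * x a < r' * x a.
  rewrite -eq_a; first by rewrite mul0r addr0 subr0 mul1r ltrDl.
  by apply/eqP; rewrite eq_le -{1}formE max_x /= (le_trans le_norm) // lerDl.
by rewrite ltNge ler_wpM2r // ltW.
Qed.

End Rotation.

(** * Walks inside a set of vertices *)

Section InnerWalks.
Variables (R : realFieldType) (T : finType) (U : {set T}) (e : rel T).
Hypotheses (e_sym : symmetric e) (e_irr : irreflexive e).
Implicit Types (f g x : T -> R).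

Definition inner_sum f b : R := \sum_(w in U | e b w) f w.
Definition inner_degree b : R := inner_sum (fun=> 1) b.
(** Twice the number of edges inside [U]. *)
Definition inner_volume : R := \sum_(b in U) inner_degree b.
Definition degree_square_sum : R := \sum_(b in U) inner_degree b ^+ 2.

(** The adjacency operator restricted to [U] is self-adjoint. *)
Lemma inner_sum_sym f g :
  \sum_(b in U) f b * inner_sum g b = \sum_(b in U) inner_sum f b * g b.
Proof.
under eq_bigr do rewrite mulr_sumr; under [RHS]eq_bigr do rewrite mulr_suml.
rewrite !pair_big_dep /= (reindex_inj (h := fun p => (p.2, p.1))); last first.
  by move=> [? ?] [? ?] [-> ->].
by apply: eq_bigl => -[b w] /=; rewrite e_sym andbCA.
Qed.

Lemma inner_sum_le f g b : (forall w, w \in U -> f w <= g w) ->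
  inner_sum f b <= inner_sum g b.
Proof. by move=> le_fg; apply: ler_sum => w /andP[/le_fg]. Qed.

Lemma inner_degree_ge0 b : 0 <= inner_degree b.
Proof. by apply: sumr_ge0. Qed.

Lemma inner_degree_le b : b \in U -> inner_degree b <= #|U|%:R - 1.
Proof.
move=> bU; rewrite lerBrDr -sumr_const (bigD1 b) //= [leLHS]addrC lerD2l.
rewrite /inner_degree /inner_sum big_mkcondr /= [leRHS]big_mkcondr /=.
apply: ler_sum => w _; case: eqVneq => [->|_]; first by rewrite e_irr.
by case: ifP.
Qed.

Lemma second_neighbors_le_volume b : b \in U ->
  inner_sum inner_degree b <= inner_volume - inner_degree b.
Proof.
move=> bU; rewrite lerBrDr /inner_volume (bigD1 b) //= [leLHS]addrC lerD2l.
rewrite /inner_sum big_mkcondr /= [leRHS]big_mkcondr /=.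
apply: ler_sum => w _; case: eqVneq => [->|_]; first by rewrite e_irr.
by case: ifP => // _; exact: inner_degree_ge0.
Qed.

(** Both sides count the walks of length two inside [U]. *)
Lemma sum_second_neighbors : \sum_(b in U) inner_sum inner_degree b = degree_square_sum.
Proof.
transitivity (\sum_(b in U) inner_sum inner_degree b * 1).
  by apply: eq_bigr => b _; rewrite mulr1.
by rewrite -inner_sum_sym; apply: eq_bigr => b _; rewrite expr2.
Qed.

Lemma inner_volume_le : inner_volume <= #|U|%:R * (#|U|%:R - 1).
Proof.
rewrite mulr_natl -sumr_const; apply: ler_sum => b; exact: inner_degree_le.
Qed.

(** A close relative of de Caen's bound on the sum of the squares of the degrees.
    At a vertex of degree [g] whose neighbours have total degree [S], one has
    [S <= m - g] and [S <= g * (d - 1)]; weight them by [g] and [d - 1 - g], and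
    add up over the vertices. *)
Lemma degree_square_sum_le (d := #|U|%:R : R) :
  (2 * d - 1) * degree_square_sum <= inner_volume * (inner_volume + (d - 1) ^+ 2).
Proof.
set W := degree_square_sum; set m := inner_volume.
suff : (d - 1) * W + (d - 1) * W <= m * (m + (d - 1) ^+ 2) - W by lra.
rewrite -{2}[W]sum_second_neighbors [leRHS]addrC.
rewrite /W /degree_square_sum !mulr_sumr -!sumrN -big_split /=.
rewrite [X in _ <= _ + X]mulrC {2}/m /inner_volume mulr_sumr -big_split /=.
apply: ler_sum => b bU; have := inner_degree_ge0 b.
have := inner_degree_le bU; have := second_neighbors_le_volume bU.
have : inner_sum inner_degree b <= inner_degree b * (d - 1).
  apply: le_trans (inner_sum_le (g := fun=> d - 1) _ _) _.
    exact: inner_degree_le.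
  by rewrite /inner_degree /inner_sum mulr_suml; under eq_bigr do rewrite -[d - 1]mul1r.
rewrite -/m -/d; move: (inner_degree b) (inner_sum _ _) => g S S1 S2 gd g0.
have p1 : 0 <= g * (m - g - S) by rewrite mulr_ge0 // subr_ge0.
have p2 : 0 <= (d - 1 - g) * (g * (d - 1) - S) by rewrite mulr_ge0 // subr_ge0.
move: p1 p2; clear; lra.
Qed.

(** Here [D] stands for the contribution of the walks inside [U] to the
    eigenvalue equation.  Expanding that equation twice writes [L ^+ 2 * D] as the
    terms with one and with two steps, plus a remainder which is [D] weighted by
    the row sums of the squared adjacency matrix of [U]; these row sums are at
    most the volume. *)
Lemma walk_sum_bound (L a : R) x :
    0 <= a -> 0 <= L -> (forall b, 0 <= x b) ->
    (forall b, b \in U -> L * x b = a + inner_sum x b) ->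
  (L ^+ 2 - inner_volume) * (\sum_(b in U) inner_sum x b) <=
    a * (inner_volume * L + degree_square_sum).
Proof.
move=> a0 L0 x0 xE; set D := \sum_(b in U) _; set m := inner_volume.
have DE : D = \sum_(b in U) inner_degree b * x b.
  by rewrite -inner_sum_sym; apply: eq_bigr => b _; rewrite mul1r.
have step f : L * \sum_(b in U) f b * x b =
    a * \sum_(b in U) f b + \sum_(b in U) inner_sum f b * x b.
  rewrite -inner_sum_sym !mulr_sumr -big_split /=; apply: eq_bigr => b bU.
  by rewrite mulrCA xE // mulrDr [a * _]mulrC.
have D1 : L * D = a * m + \sum_(b in U) inner_sum inner_degree b * x b.
  by rewrite DE step.
have D2 : L * (L * D) = a * m * L + a * degree_square_sum +
    \sum_(b in U) inner_sum inner_degree b * inner_sum x b.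
  rewrite D1 mulrDr step sum_second_neighbors [in RHS]inner_sum_sym; ring.
have : \sum_(b in U) inner_sum inner_degree b * inner_sum x b <= m * D.
  rewrite mulr_sumr; apply: ler_sum => b bU; apply: ler_wpM2r.
    by apply: sumr_ge0.
  by apply: le_trans (second_neighbors_le_volume bU) _; rewrite gerBl inner_degree_ge0.
lra.
Qed.

End InnerWalks.

(** * Graphs with two hubs *)

(** The vertex [v] dominates the graph, and, once [v] is deleted, the neighbours of
    every vertex other than [u] lie in the closed neighbourhood of [u].  Hence the
    graph is the join of [v] with the disjoint union of isolated vertices and of
    the join of [u] with an arbitrary graph on [middle v u]. *)
Definition hub_pair (G : sgraph) (v u : G) :=
  [/\ u != v, forall w, w != v -> adj v w &
      forall b w, b \notin [:: v; u] -> w \notin [:: v; u] -> adj b w -> adj u w].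

Definition middle (G : sgraph) (v u : G) := [set w | (w != v) && adj u w].

(** The vertices whose only neighbour is [v]. *)
Definition pendant (G : sgraph) (v u : G) :=
  [set w | (w \notin [:: v; u]) && ~~ adj u w].

Lemma hub_pair_connected (G : sgraph) (a b : G) : hub_pair a b -> connected G.
Proof.
move=> [_ adj_a _]; split=> [|x y]; first by apply/card_gt0P; exists a.
have conn_a z : connect (@adj G) a z.
  by have [->|/adj_a/connect1] := eqVneq z a.
by apply: connect_trans (conn_a y); rewrite (sym_connect_sym (@adj_sym G)).
Qed.

Section HubPair.
Variables (R : realFieldType) (G : sgraph) (v u : G).
Hypothesis hubs : hub_pair v u.
Local Notation U := (middle v u).
Local Notation Z := (pendant v u).
Local Notation inner := (inner_sum U (@adj G)).
Implicit Type x : G -> R.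

Lemma sum_hub_pair (V : nmodType) (f : G -> V) :
  \sum_w f w = f v + f u + \sum_(w in U) f w + \sum_(w in Z) f w.
Proof.
have [neq_uv _ _] := hubs.
rewrite (bigD1 v) //= (bigD1 u) //= addrA -[RHS]addrA; congr (_ + _).
rewrite (bigID [in U]) /=; congr (_ + _); apply: eq_bigl => w.
  rewrite !inE; case: (w != v) => //=; case: eqVneq => //= ->.
  by rewrite adj_irr.
by rewrite !inE negb_or -andbA; case: (w != v) => //=.
Qed.

Lemma neighbor_sum_first_hub x :
  neighbor_sum x v = x u + \sum_(w in U) x w + \sum_(w in Z) x w.
Proof.
have [neq_uv adj_v _] := hubs.
apply: (addrI (x v)); rewrite !addrA -sum_hub_pair (bigD1 v) //=.
congr (_ + _); apply: eq_bigl => w; case: eqVneq => [->|/adj_v -> //].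
by rewrite adj_irr.
Qed.

Lemma neighbor_sum_second_hub x : neighbor_sum x u = x v + \sum_(w in U) x w.
Proof.
have [neq_uv adj_v _] := hubs.
rewrite /neighbor_sum (bigD1 v) /=; last by rewrite adj_sym adj_v.
by congr (_ + _); apply: eq_bigl => w; rewrite inE andbC.
Qed.

Lemma neighbor_sum_middle x b : b \in U -> neighbor_sum x b = x v + x u + inner x b.
Proof.
have [neq_uv adj_v nest] := hubs; rewrite inE => /andP[bv ub].
have bu : b != u by apply: contraTneq ub => ->; rewrite adj_irr.
rewrite /neighbor_sum (bigD1 v) /=; last by rewrite adj_sym adj_v.
rewrite (bigD1 u) /= ?addrA; last by rewrite adj_sym ub.
congr (_ + _); apply: eq_bigl => w; rewrite !inE.
case bw: (adj b w); rewrite ?andbF //=.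
case: eqVneq => //= wv; case: eqVneq => [->|wu] /=; first by rewrite adj_irr.
by rewrite (nest b) // !inE negb_or ?bv ?wv.
Qed.

Lemma neighbor_sum_pendant x b : b \in Z -> neighbor_sum x b = x v.
Proof.
have [neq_uv adj_v nest] := hubs; rewrite inE => /andP[bvu not_ub].
have := bvu; rewrite !inE negb_or => /andP[bv bu].
rewrite /neighbor_sum (bigD1 v) /=; last by rewrite adj_sym adj_v.
rewrite big1 ?addr0 // => w /andP[bw wv]; case/negP: not_ub.
have [e|wu] := eqVneq w u; first by rewrite -e adj_sym.
by apply: (nest w) => //; rewrite ?inE ?negb_or ?wv // adj_sym.
Qed.

Lemma hub_pair_card : #|G| = (2 + #|U| + #|Z|)%N.
Proof.
apply/eqP; rewrite -(eqr_nat rat) -sumr_const sum_hub_pair !sumr_const !natrD.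
by apply/eqP; ring.
Qed.

Lemma hub_pair_edges :
  (2 * #|edges G|)%N%:R =
  2 * (#|G|%:R - 1 + #|U|%:R) + inner_volume R U (@adj G).
Proof.
have -> : (2 * #|edges G|)%N%:R =
    \sum_(w : G) neighbor_sum (fun=> 1 : R) w.
  rewrite -handshake natr_sum; apply: eq_bigr => w _.
  by rewrite /neighbor_sum sumr_const.
rewrite sum_hub_pair neighbor_sum_first_hub neighbor_sum_second_hub.
rewrite (eq_bigr _ (fun b bU => neighbor_sum_middle _ bU)).
rewrite [X in _ + X](eq_bigr _ (fun b bZ => neighbor_sum_pendant _ bZ)).
rewrite hub_pair_card !sumr_const big_split /= sumr_const !natrD.
rewrite /inner_volume /inner_degree.
move: (\sum_(b in _) _) => m; rewrite -[2 *+ _]mulr_natr.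
ring.
Qed.

Variable x : G -> R.
Variable L : R.
Hypotheses (x0 : forall w, 0 < x w) (L0 : 0 < L).
Hypothesis xE : forall w, neighbor_sum x w = L * x w.

Let D := \sum_(b in U) inner x b.

Lemma eigen_middle_sum :
  L * \sum_(w in U) x w = #|U|%:R * (x u + x v) + D.
Proof.
rewrite mulr_sumr mulr_natl -sumr_const -big_split /=.
by apply: eq_bigr => b bU; rewrite -xE neighbor_sum_middle // [x v + _]addrC.
Qed.

Lemma eigen_second_hub :
  L ^+ 2 * x u = L * x v + #|U|%:R * (x u + x v) + D.
Proof.
by rewrite expr2 -mulrA -xE neighbor_sum_second_hub mulrDr eigen_middle_sum addrA.
Qed.

Lemma eigen_first_hub :
  L ^+ 2 * x v = L * x u + #|U|%:R * (x u + x v) + D + #|Z|%:R * x v.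
Proof.
have sumZ : L * \sum_(w in Z) x w = #|Z|%:R * x v.
  rewrite mulr_sumr mulr_natl -sumr_const.
  by apply: eq_bigr => b bZ; rewrite -xE neighbor_sum_pendant.
by rewrite expr2 -mulrA -xE neighbor_sum_first_hub [L * _]mulrDr [L * _]mulrDr
  eigen_middle_sum sumZ !addrA.
Qed.

Lemma eigen_middle_bound (m := inner_volume R U (@adj G)) :
  (L ^+ 2 - m) * D <= (x u + x v) * (m * L + degree_square_sum R U (@adj G)).
Proof.
apply: walk_sum_bound => [|||||b bU].
- exact: adj_sym.
- exact: adj_irr.
- by rewrite addr_ge0 ?ltW.
- exact: ltW.
- by move=> b; apply: ltW.
- by rewrite -xE neighbor_sum_middle // [x v + _]addrC.
Qed.

End HubPair.

(** Take for [v] a vertex with the largest Perron entry and for [u] a vertex with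
    the largest one among the others.  An edge [b w] with [w] not adjacent to [v],
    where [b] is a neighbour of [v], could be rotated to [v w]; so the closed
    neighbourhood of [v] is closed under adjacency, hence is everything.  Then
    [v] keeps every rotated graph connected, and the same argument at [u] gives
    the nesting of neighbourhoods. *)
Lemma maximal_hub_pair (R : realType) (G : sgraph) :
    connected G -> (1 < #|G|)%N ->
    (forall H : sgraph, connected H -> #|H| = #|G| -> #|edges H| = #|edges G| ->
       spectral_radius R H <= spectral_radius R G) ->
  exists v u : G, hub_pair v u.
Proof.
move=> connG G1 maxG; have [x x0 xE] := perron R connG.
have stuck (a b w : G) : adj b w -> a != w -> a != b -> x b <= x a ->
    connect (@adj (rotated a b w)) b w -> adj a w.
  move=> bw aw ab le_ba conn_bw; apply/negPn/negP => not_aw.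
  have := spectral_radius_rotated bw not_aw aw ab x0 xE le_ba.
  rewrite ltNge maxG //; first exact: rotated_connected.
  exact: (card_edges_rotated bw not_aw aw ab).
have [G0 conn] := connG; have /card_gt0P[v0 _] := G0.
pose v := [arg max_(i > v0) x i]%O.
have x_max w : x w <= x v by rewrite /v; case: Order.TotalTheory.arg_maxP => // i _; exact.
clearbody v.
(* Rotation of [b z] to [v z], when [b] is adjacent to [v] and [z] is not: the
   path [b v z] replaces the lost edge. *)
have adj_v w : w != v -> adj v w.
  have closed_v b z : (b == v) || adj v b -> adj b z -> (z == v) || adj v z.
    case/predU1P => [-> ->|vb bz]; first by rewrite orbT.
    case: eqVneq => //= zv; apply: (stuck v b z) => //; first by rewrite eq_sym.
      by apply: contraTneq vb => ->; rewrite adj_irr.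
    have vb' : v != b by apply: contraTneq vb => ->; rewrite adj_irr.
    apply: (@connect_trans _ _ v); apply: connect1; last first.
      by apply: rotated_new; rewrite eq_sym.
    apply: rotated_kept; first by rewrite adj_sym.
    by rewrite /is_pair [v == z]eq_sym (negPf zv) (negPf vb') !andbF.
  move=> wv; suff : (w == v) || adj v w by rewrite (negPf wv).
  have walk p z : (z == v) || adj v z -> path (@adj G) z p ->
      (last z p == v) || adj v (last z p).
    elim: p z => //= b p IH z Pz /andP[zb]; exact/IH/(closed_v _ _ Pz zb).
  by have /connectP[p pth ->] := conn v w; apply: walk pth; rewrite eqxx.
have [v1 v1v] : exists v1, v1 != v.
  have /card_gt0P[v1 v1v] : (0 < #|predC1 v|)%N.
    by rewrite cardC1 -subn1 subn_gt0.
  by exists v1.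
pose u := [arg max_(i > v1 | i != v) x i]%O.
have [uv u_max] : u != v /\ forall w, w != v -> x w <= x u.
  by rewrite /u; case: Order.TotalTheory.arg_maxP.
clearbody u; exists v, u; split=> // b w.
rewrite !inE !negb_or => /andP[bv bu] /andP[wv wu] bw.
apply: (stuck u b w) => //; rewrite 1?eq_sym ?u_max //.
apply: (@connect_trans _ _ v); apply/connect1/rotated_kept.
- by rewrite adj_sym adj_v.
- by rewrite /is_pair ![v == _]eq_sym (negPf bv) (negPf wv) !andbF.
- exact: adj_v.
- by rewrite /is_pair ![v == _]eq_sym (negPf bv) (negPf wv).
Qed.

(** * Graphs with two hubs and an independent middle *)

Lemma colour_preserving_bijection (K : eqType) (S T : finType) (c : S -> K) (c' : T -> K) :
    #|S| = #|T| ->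
    (forall k, #|[pred s | c s == k]| = #|[pred t | c' t == k]|) ->
  exists2 f : S -> T, bijective f & forall s, c' (f s) = c s.
Proof.
move=> card_ST card_c.
have [S0|/card_gt0P[s0 _]] := posnP #|S|.
  have noS (s : S) : False by have := fintype0 s S0.
  exists (fun s => False_rect T (noS s)) => [|s]; last by have := noS s.
  by apply: inj_card_bij => [s|]; [have := noS s | rewrite -card_ST].
have [t0 _] : exists t0 : T, true.
  have : (0 < #|T|)%N by rewrite -card_ST; apply/card_gt0P; exists s0.
  by move=> /card_gt0P[t0 _]; exists t0.
pose ES k := enum [pred s | c s == k]; pose ET k := enum [pred t | c' t == k].
have sizeE k : size (ES k) = size (ET k) by rewrite -!cardE card_c.
have mem_ES s : s \in ES (c s) by rewrite mem_enum inE.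
pose f s := nth t0 (ET (c s)) (index s (ES (c s))).
have idx s : (index s (ES (c s)) < size (ET (c s)))%N by rewrite -sizeE index_mem.
have cf s : c' (f s) = c s.
  by have := mem_nth t0 (idx s); rewrite mem_enum inE => /eqP.
exists f => //; apply: inj_card_bij; last by rewrite card_ST.
move=> s s' eq_f; have eq_c : c s = c s' by rewrite -!cf eq_f.
have ES_s' : s' \in ES (c s) by rewrite eq_c.
rewrite -(nth_index s (mem_ES s)) -[RHS](nth_index s ES_s'); congr nth.
apply/eqP; rewrite -(nth_uniq t0 _ _ (enum_uniq _) (s := ET (c s))) ?idx //.
  by apply/eqP; move: eq_f; rewrite /f -eq_c.
by rewrite eq_c.
Qed.

Section StarHub.
Variables (G : sgraph) (v u : G).
Hypothesis hubs : hub_pair v u.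
Hypothesis no_inner : forall b w, b \in middle v u -> w \in middle v u -> ~~ adj b w.

(** When no two vertices of [middle v u] are adjacent, adjacency only depends on
    the kinds of the two vertices. *)
Definition hub_kind w : nat :=
  if w == v then 0 else if w == u then 1 else if adj u w then 2 else 3.

Lemma adj_hub_kind b w : adj b w =
  ((hub_kind b, hub_kind w)
     \in [:: (0, 1); (0, 2); (0, 3); (1, 2); (1, 0); (2, 0); (3, 0); (2, 1)])%N.
Proof.
have [neq_uv adj_v nest] := hubs.
have adj_v' z : z != v -> adj z v by rewrite adj_sym; apply: adj_v.
rewrite /hub_kind.
have [->|bv] := eqVneq b v; have [->|wv] := eqVneq w v; rewrite ?adj_irr //.
- by rewrite adj_v //; do 2?case: ifP.
- by rewrite adj_v' //; do 2?case: ifP.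
have [->|bu] := eqVneq b u; have [->|wu] := eqVneq w u; rewrite ?adj_irr //.
- by case: ifP.
- by rewrite adj_sym; case: ifP.
have [ub|not_ub] := boolP (adj u b); have [uw|not_uw] := boolP (adj u w) => /=.
- by apply/negbTE/no_inner; rewrite inE ?bv ?wv.
- apply: contraNF not_uw; apply: nest; by rewrite !inE negb_or ?bv ?wv.
- apply: contraNF not_ub; rewrite adj_sym; apply: nest;
    by rewrite !inE negb_or ?bv ?wv.
- apply: contraNF not_uw; apply: nest; by rewrite !inE negb_or ?bv ?wv.
Qed.

End StarHub.

Definition star_hub_pair (G : sgraph) (v u : G) :=
  hub_pair v u /\
  forall b w, b \in middle v u -> w \in middle v u -> ~~ adj b w.

Lemma card_hub_kind (G : sgraph) (v u : G) : hub_pair v u -> forall k,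
  #|[pred w | hub_kind v u w == k]| =
  (match k with 0 | 1 => 1 | 2 => #|middle v u| | 3 => #|pendant v u| | _ => 0 end)%N.
Proof.
move=> [neq_uv adj_v nest] k.
have kindE w : (hub_kind v u w == k) = match k with
    | 0 => w == v | 1 => w == u | 2 => w \in middle v u
    | 3 => w \in pendant v u | _ => false end%N.
  rewrite /hub_kind !inE negb_or; case: (eqVneq w v) => [->|wv].
    by rewrite [v == u]eq_sym (negPf neq_uv); case: k => [|[|[|[|?]]]].
  case: (eqVneq w u) => [->|wu]; first by rewrite adj_irr; case: k => [|[|[|[|?]]]].
  by case: ifP; case: k => [|[|[|[|?]]]].
case: k kindE => [|[|[|[|k]]]] kindE.
- by rewrite -[RHS](card1 v); apply: eq_card => w; rewrite !inE kindE.
- by rewrite -[RHS](card1 u); apply: eq_card => w; rewrite !inE kindE.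
- by apply: eq_card => w; rewrite inE kindE.
- by apply: eq_card => w; rewrite inE kindE.
- by apply: eq_card0 => w; rewrite inE kindE.
Qed.

Lemma star_hub_pair_isomorphic (G H : sgraph) (v u : G) (v' u' : H) :
    star_hub_pair v u -> star_hub_pair v' u' ->
    #|middle v u| = #|middle v' u'| -> #|G| = #|H| -> isomorphic G H.
Proof.
move=> [hubs no_in] [hubs' no_in'] card_U card_GH.
have card_Z : #|pendant v u| = #|pendant v' u'|.
  have := card_GH; rewrite (hub_pair_card hubs) (hub_pair_card hubs') card_U.
  exact: addnI.
have [|f bij_f kind_f] :=
    colour_preserving_bijection (c := hub_kind v u) (c' := hub_kind v' u') card_GH.
  by move=> k; rewrite !card_hub_kind // card_U card_Z.
exists f => // x y.
by rewrite (adj_hub_kind hubs' no_in') (adj_hub_kind hubs no_in) !kind_f.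
Qed.

Lemma inner_volume_eq0 (R : realFieldType) (G : sgraph) (v u : G) :
  reflect (forall b w, b \in middle v u -> w \in middle v u -> ~~ adj b w)
    (inner_volume R (middle v u) (@adj G) == 0).
Proof.
rewrite /inner_volume psumr_eq0 => [|b _]; last exact: inner_degree_ge0.
apply: (iffP allP) => [vol0 b w bU wU|no_in b _].
  apply/negP => bw; have := vol0 b (mem_index_enum b).
  rewrite bU /= psumr_eq0 // => /allP/(_ w (mem_index_enum w)).
  by rewrite wU bw oner_eq0.
apply/implyP => bU; rewrite /inner_degree /inner_sum big1 // => w /andP[wU].
by rewrite (negPf (no_in b w _ _)).
Qed.

Lemma star_hub_pair_radius (R : realType) (G : sgraph) (v u : G) :
    star_hub_pair v u -> connected G ->
  let L := spectral_radius R G in let d : R := #|middle v u|%:R in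
  let z : R := #|pendant v u|%:R in
  [/\ 0 < L, d + z < L ^+ 2 & (L ^+ 2 - d) * (L ^+ 2 - d - z) = (L + d) ^+ 2].
Proof.
move=> [hubs no_in] connG L d z; have [x x0 xE] := perron R connG; rewrite -/L in xE.
have L0 : 0 < L.
  rewrite -(pmulr_lgt0 _ (x0 u)) -xE (neighbor_sum_second_hub hubs).
  by rewrite ltr_pwDl // sumr_ge0 // => w _; apply: ltW.
have := eigen_middle_bound hubs x0 L0 xE.
have eq_u := eigen_second_hub hubs xE.
have eq_v := eigen_first_hub hubs xE.
set D := \sum_(b in _) _ in eq_u eq_v *.
have D0 : D = 0.
  rewrite /D big1 // => b bU; rewrite /inner_sum big1 // => w /andP[wU].
  by rewrite (negPf (no_in b w _ _)).
move=> _; rewrite D0 !addr0 -/d -/z in eq_u eq_v.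
move: (x u) (x v) (x0 u) (x0 v) eq_u eq_v => xu xv xu0 xv0 eq_u eq_v.
have d0 : 0 <= d by rewrite ler0n.
have Ld : 0 < L + d by rewrite ltr_pwDl.
have eq_u' : (L ^+ 2 - d) * xu = (L + d) * xv by rewrite mulrBl eq_u; ring.
have eq_v' : (L ^+ 2 - d - z) * xv = (L + d) * xu.
  by rewrite 2!mulrBl eq_v; ring.
split=> //.
  by rewrite -subr_gt0 opprD addrA -(pmulr_lgt0 _ xv0) eq_v' mulr_gt0.
apply: (mulIf (lt0r_neq0 (mulr_gt0 xu0 xv0))).
transitivity (((L ^+ 2 - d) * xu) * ((L ^+ 2 - d - z) * xv)); first by ring.
by rewrite eq_u' eq_v'; ring.
Qed.

(** Both [(L ^+ 2 - e) / (L + e)] and [(L ^+ 2 - c) / (L + e)] increase with [L], so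
    an equation satisfied at [m] becomes an inequality at [L]. *)
Lemma star_radius_mono (R : realFieldType) (e c m L : R) :
    0 <= e -> e <= c -> 0 < m -> m <= L -> c < m ^+ 2 ->
    (m ^+ 2 - e) * (m ^+ 2 - c) = (m + e) ^+ 2 ->
  c < L ^+ 2 /\ (L + e) ^+ 2 <= (L ^+ 2 - e) * (L ^+ 2 - c).
Proof.
move=> e0 ec m0 mL cm eq_m; have L0 := lt_le_trans m0 mL.
have sq_le : m ^+ 2 <= L ^+ 2 by rewrite ler_sqr ?nnegrE ?(ltW m0) ?(ltW L0).
have cL := lt_le_trans cm sq_le; split=> //.
(* The cleared form of the monotonicity of [(L ^+ 2 - a) / (L + e)]. *)
have cross a : 0 <= a -> (m ^+ 2 - a) * (L + e) <= (L ^+ 2 - a) * (m + e).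
  move=> a0; rewrite -subr_ge0.
  have -> : (L ^+ 2 - a) * (m + e) - (m ^+ 2 - a) * (L + e) =
      L * m * (L - m) + e * (L ^+ 2 - m ^+ 2) + a * (L - m) by ring.
  have dif0 : 0 <= L ^+ 2 - m ^+ 2 by rewrite subr_ge0.
  have {}mL : 0 <= L - m by rewrite subr_ge0.
  by rewrite !addr_ge0 ?mulr_ge0 ?(ltW m0) ?(ltW L0).
have me0 : 0 < m + e by rewrite ltr_pwDl.
rewrite -(ler_pM2l (exprn_gt0 2 me0)) -{1}eq_m.
have -> : (m ^+ 2 - e) * (m ^+ 2 - c) * (L + e) ^+ 2 =
  ((m ^+ 2 - e) * (L + e)) * ((m ^+ 2 - c) * (L + e)) by ring.
have -> : (m + e) ^+ 2 * ((L ^+ 2 - e) * (L ^+ 2 - c)) =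
  ((L ^+ 2 - e) * (m + e)) * ((L ^+ 2 - c) * (m + e)) by ring.
have c0 := le_trans e0 ec; have em := le_lt_trans ec cm.
have Le0 : 0 <= L + e by rewrite addr_ge0 // ltW.
by apply: ler_pM; rewrite ?cross // mulr_ge0 // subr_ge0 ltW.
Qed.

(** * The numerical comparison *)

(** The decisive inequality, in terms of [p = sqrt (2 e)]; a complete graph with
    [e] edges has about [p + 1 / 2] vertices, and [d] can be as small as
    [p - 1 / 2].  Once [p], [L] and [d] are written as their lower bounds plus
    nonnegative increments, the difference of the two sides is a polynomial in
    these increments all of whose coefficients are positive. *)
Lemma clique_star_inequality (R : realFieldType) (p L d : R) :
    1618 / 100 <= p -> p + 265 / 100 <= L -> p - 1 / 2 <= d ->
  let e := p ^+ 2 / 2 in let s := e - d in let M := L ^+ 2 in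
  (2 * L + (d + p - 24 / 10)) * (M * (L + 1) ^+ 2 - s * (M - e)) <
  (M - 2 * s) * (M * (2 * L + 1 + e + d) - e * d).
Proof.
move=> p_ge L_ge d_ge /=.
have [h h0 pE] : exists2 h, 0 <= h & p = 1618 / 100 + h.
  by exists (p - 1618 / 100); [lra | ring].
have [k k0 ->] : exists2 k, 0 <= k & L = p + 265 / 100 + k.
  by exists (L - (p + 265 / 100)); [lra | ring].
have [t t0 ->] : exists2 t, 0 <= t & d = p - 1 / 2 + t.
  by exists (d - (p - 1 / 2)); [lra | ring].
rewrite {L_ge d_ge p_ge}pE.
have mono i j l : 0 <= h ^+ i * k ^+ j * t ^+ l by rewrite !mulr_ge0 ?exprn_ge0.
(* These are the monomials of that polynomial. *)
move: (mono 0 0 1) (mono 0 0 2) (mono 0 1 0) (mono 0 1 1) (mono 0 1 2)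
(mono 0 2 0) (mono 0 2 1) (mono 0 2 2) (mono 0 3 0) (mono 0 4 0)
(mono 1 0 0) (mono 1 0 1) (mono 1 0 2) (mono 1 1 0) (mono 1 1 1)
(mono 1 1 2) (mono 1 2 0) (mono 1 2 1) (mono 1 3 0) (mono 1 4 0)
(mono 2 0 0) (mono 2 0 1) (mono 2 0 2) (mono 2 1 0) (mono 2 1 1)
(mono 2 2 0) (mono 2 3 0) (mono 2 4 0) (mono 3 0 0) (mono 3 0 1)
(mono 3 1 0) (mono 3 2 0) (mono 3 3 0) (mono 4 0 0) (mono 4 0 1)
(mono 4 1 0) (mono 4 2 0) (mono 5 0 0) (mono 5 1 0).
rewrite !expr0 !expr1.
lra.
Qed.

(** Completing the square in the hypothesis gives
    [L ^+ 2 >= 2 e + L + delta / 2], and [delta] is at least a multiple of [p].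
    It is the excess of [L] over [p] that separates the star from the clique. *)
Lemma star_radius_lower_bound (R : realFieldType) (p L delta : R) :
    1618 / 100 <= p -> 919 / 100 * p <= delta -> 0 < L ->
    p ^+ 2 / 2 + delta < L ^+ 2 ->
    (L + p ^+ 2 / 2) ^+ 2 <=
      (L ^+ 2 - p ^+ 2 / 2) * (L ^+ 2 - p ^+ 2 / 2 - delta) ->
  p + 265 / 100 <= L.
Proof.
move=> p_ge delta_ge L0 gap sq_le; set e := p ^+ 2 / 2 in gap sq_le *.
have e0 : 0 <= e by rewrite divr_ge0 ?sqr_ge0.
have le_sq : (L + e) ^+ 2 <= (L ^+ 2 - e - delta / 2) ^+ 2.
  by apply: (le_trans sq_le); rewrite -subr_ge0; have := sqr_ge0 delta; lra.
rewrite ler_sqr ?nnegrE in le_sq; [|lra|lra].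
rewrite leNgt; apply/negP => L_lt.
have : L * (L - 1) < (p + 265 / 100) * (p + 265 / 100 - 1).
  have [L1|L1] := ltP 1 L; first by apply: ltr_pM; lra.
  have : L * (L - 1) <= 0 by apply: mulr_ge0_le0; lra.
  by move/le_lt_trans; apply; apply: mulr_gt0; lra.
move: le_sq; rewrite /e; lra.
Qed.

(** After division by [2 * d - 1], the hypothesis bounds [W / s] by about
    [d + 4 * s / (2 * d - 1)].  With [d + s] fixed the last term decreases in [d],
    and it equals [p - 1] at the smallest possible value [p - 1 / 2] of [d], the
    case of a clique. *)
Lemma second_moment_bound (R : realFieldType) (p d s W : R) :
    1618 / 100 <= p -> d + s = p ^+ 2 / 2 -> p - 1 / 2 <= d -> 0 < s ->
    (2 * d - 1) * W <= 2 * s * (2 * s + (d - 1) ^+ 2) ->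
  W <= s * (d + p - 24 / 10).
Proof.
move=> p_ge sE d_ge s0 W_le.
have d2 : 0 < 2 * d - 1 by lra.
rewrite -(ler_pM2l d2); apply: (le_trans W_le).
have -> : 2 * s * (2 * s + (d - 1) ^+ 2) = s * (4 * s + 2 * (d - 1) ^+ 2) by ring.
rewrite [leRHS]mulrCA ler_pM2l //.
have {sE}-> : s = p ^+ 2 / 2 - d by rewrite -sE addrC addKr.
have : 0 <= (d - (p - 1 / 2)) * (p - 9 / 10) by apply: mulr_ge0; lra.
lra.
Qed.

(** Eliminating [xu] and [xv] gives [Y * (Y - delta - s) = (L + q) ^+ 2] with
    [Y = L ^+ 2 - q], and the last hypothesis is the corresponding inequality for
    [q = e], [s = 0].  As [L + q = K - Y] with [K = L * (L + 1)], both become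
    comparisons of [delta] with [2 * K - K ^+ 2 / Y], and [delta] cancels out. *)
Lemma join_eigen_comparison (R : realFieldType) (e q s delta L xu xv : R) :
    0 < L -> 0 < xu -> 0 < xv -> 0 <= q -> e < L ^+ 2 ->
    L ^+ 2 * xu = L * xv + q * (xu + xv) ->
    L ^+ 2 * xv = L * xu + q * (xu + xv) + (delta + s) * xv ->
    (L + e) ^+ 2 <= (L ^+ 2 - e) * (L ^+ 2 - e - delta) ->
  (L * (L + 1)) ^+ 2 * (e - q) <= s * (L ^+ 2 - e) * (L ^+ 2 - q).
Proof.
move=> L0 xu0 xv0 q0 e_lt eq_u eq_v sq_le.
pose Y := L ^+ 2 - q; pose y := L ^+ 2 - e; pose K := L * (L + 1).
have eq_u' : Y * xu = (L + q) * xv by rewrite /Y mulrBl eq_u; ring.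
have eq_v' : (Y - delta - s) * xv = (L + q) * xu.
  transitivity (L ^+ 2 * xv - (q + delta + s) * xv); first by rewrite /Y; ring.
  by rewrite eq_v; ring.
have Y0 : 0 < Y.
  by rewrite -(pmulr_lgt0 _ xu0) eq_u' mulr_gt0 // ltr_pwDl.
have y0 : 0 < y by rewrite subr_gt0.
have YE : (delta + s) * Y = 2 * K * Y - K ^+ 2.
  have -> : K = (L + q) + Y by rewrite /K /Y; ring.
  have : Y * (Y - delta - s) = (L + q) ^+ 2.
    apply: (mulIf (lt0r_neq0 (mulr_gt0 xu0 xv0))).
    transitivity ((Y * xu) * ((Y - delta - s) * xv)); first by ring.
    by rewrite eq_u' eq_v'; ring.
  by clear; lra.
have yE : delta * y <= 2 * K * y - K ^+ 2.
  have -> : K = (L + e) + y by rewrite /K /y; ring.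
  by move: sq_le; rewrite -/y; clear; lra.
have -> : e - q = Y - y by rewrite /Y /y; ring.
rewrite -/Y -/y -/K.
have := ler_wpM2r (ltW Y0) yE; have := congr1 ( *%R y) YE.
by move: Y y K {Y0 y0 eq_u' eq_v' YE yE} => Y y K; clear; lra.
Qed.

(** The contribution [D] of the edges inside [middle v u] acts as if the degree
    [d] were increased to [q = d + P], where [P = D / (xu + xv)].  The walk bound
    limits [P], while [join_eigen_comparison] needs [P] to make up for the [s]
    edges that [u] has lost; [clique_star_inequality] says that it cannot. *)
Lemma star_dominates (R : rcfType) (e d s delta L W xu xv D : R) :
    131 <= e -> 13 * Num.sqrt e <= delta -> d + s = e -> 0 <= d -> 0 < s ->
    2 * s <= d * (d - 1) ->
    (2 * d - 1) * W <= 2 * s * (2 * s + (d - 1) ^+ 2) ->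
    0 < L -> e + delta < L ^+ 2 ->
    (L + e) ^+ 2 <= (L ^+ 2 - e) * (L ^+ 2 - e - delta) ->
    0 < xu -> 0 < xv -> 0 <= D ->
    (L ^+ 2 - 2 * s) * D <= (xu + xv) * (2 * s * L + W) ->
    L ^+ 2 * xu = L * xv + d * (xu + xv) + D ->
    L ^+ 2 * xv = L * xu + d * (xu + xv) + D + (delta + s) * xv ->
  False.
Proof.
move=> e_ge delta_ge sE d0 s0 s_le W_le L0 gap sq_le xu0 xv0 D0 D_le eq_u eq_v.
have le_of_sq (x y : R) : 0 <= x -> 0 <= y -> x ^+ 2 <= y ^+ 2 -> x <= y.
  by move=> x0 y0; rewrite ler_sqr.
have e0 : 0 <= e by apply: le_trans e_ge.
pose p := Num.sqrt (2 * e).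
have p0 : 0 <= p by apply: sqrtr_ge0.
have p2 : p ^+ 2 = 2 * e by rewrite sqr_sqrtr // mulr_ge0.
have eE : e = p ^+ 2 / 2 by rewrite p2; field.
(* [1618 / 100] is just below [sqrt (2 * 131)]. *)
have p_ge : 1618 / 100 <= p.
  by apply: le_of_sq => //; rewrite ?p2; move: e_ge; clear; lra.
(* [919 / 100] is just below [13 / sqrt 2]. *)
have delta_p : 919 / 100 * p <= delta.
  apply: le_trans delta_ge; have := sqrtr_ge0 e; have := sqr_sqrtr e0.
  set q := Num.sqrt e => q2 q0.
  by apply: le_of_sq; rewrite ?exprMn ?q2 ?p2; move: q0 p0 e0; clear; lra.
have L_ge : p + 265 / 100 <= L.
  by apply: (star_radius_lower_bound (delta := delta)); rewrite -?eE.
have d_ge : p - 1 / 2 <= d.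
  suff : p <= d + 1 / 2 by clear; lra.
  apply: le_of_sq => //; first by move: d0; clear; lra.
  by rewrite p2; move: s_le sE; clear; lra.
have W_le' := second_moment_bound p_ge (etrans sE eE) d_ge s0 W_le.
have := clique_star_inequality p_ge L_ge d_ge.
rewrite /= -eE; have -> : e - d = s by rewrite -sE addrC addKr.
set w := d + p - 24 / 10 in W_le' *; set K := L * (L + 1).
have KE : L ^+ 2 * (L + 1) ^+ 2 = K ^+ 2 by rewrite exprMn.
have -> : L ^+ 2 * (2 * L + 1 + e + d) - e * d = K ^+ 2 - (L ^+ 2 - e) * (L ^+ 2 - d).
  by rewrite /K; ring.
rewrite KE => key.
have a0 : 0 < xu + xv by apply: addr_gt0.
pose P := D / (xu + xv).
have DE : D = P * (xu + xv) by rewrite divfK // gt_eqF.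
have P0 : 0 <= P by rewrite divr_ge0 // ltW.
have P_le : (L ^+ 2 - 2 * s) * P <= s * (2 * L + w).
  rewrite -(ler_pM2r a0) -mulrA -DE (le_trans D_le) // mulrC ler_pM2r //.
  by move: W_le'; clear; lra.
have M_ge : 2 * e <= L ^+ 2.
  rewrite -p2 ler_sqr ?nnegrE //; last exact: ltW.
  by move: L_ge; clear; lra.
have M2s : 0 < L ^+ 2 - 2 * s by move: sE d_ge p_ge M_ge; clear; lra.
have c0 : 0 <= K ^+ 2 - s * (L ^+ 2 - e).
  suff -> : K ^+ 2 - s * (L ^+ 2 - e) =
      L ^+ 2 * (L ^+ 2 - s) + L ^+ 2 * (2 * L + 1) + s * e.
    rewrite !addr_ge0 ?mulr_ge0 ?exprn_ge0 ?(ltW L0) ?(ltW s0) //;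
      by move: M2s s0 L0; clear; lra.
  by rewrite /K; ring.
have := @join_eigen_comparison R e (d + P) s delta L xu xv L0 xu0 xv0.
have -> : e - (d + P) = s - P by rewrite -sE; ring.
rewrite -/K; move=> cmp; have {cmp} : K ^+ 2 * (s - P) <=
    s * (L ^+ 2 - e) * (L ^+ 2 - (d + P)).
  apply: cmp => //; first exact: addr_ge0.
  - by move: M_ge e_ge; clear; lra.
  - by rewrite eq_u DE; ring.
  - by rewrite eq_v DE; ring.
apply/negP; rewrite -ltNge -(ltr_pM2l M2s).
rewrite -(ltr_pM2l s0) in key.
have := ler_wpM2l c0 P_le; move: key; rewrite -sE.
by move: (L ^+ 2) (K ^+ 2) => M K2; clear; lra.
Qed.

(** * Existence of a maximizer and conclusion *)

Lemma graph_class_isomorphic (n e : nat) (G H : sgraph) :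
  isomorphic G H -> graph_class n e G -> graph_class n e H.
Proof.
move=> [f [g fK gK] fadj] [[G0 conn] card_G edges_G].
have bij_f : bijective f := Bijective fK gK.
have card_H : #|H| = #|G| by rewrite (bij_eq_card bij_f).
split; last 2 first.
- by rewrite card_H.
- rewrite -edges_G; apply/eqP; rewrite -(eqn_pmul2l (isT : 0 < 2)%N) -!handshake.
  rewrite (reindex f) /=; last exact/onW_bij.
  apply/eqP; apply: eq_bigr => x _; rewrite -!sum1_card (reindex f) /=.
    by apply: eq_bigl => y; apply: fadj.
  exact/onW_bij.
split=> [|x y]; first by rewrite card_H.
rewrite -(gK x) -(gK y); have /connectP[p pth ->] := conn (g x) (g y).
elim: p (g x) pth => [|b p IH] a //= /andP[ab /IH]; apply: connect_trans.
by apply: connect1; rewrite fadj.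
Qed.

Section Relabelling.
Variable n : nat.

Definition relation_adj (F : {ffun 'I_n * 'I_n -> bool}) : rel 'I_n :=
  fun i j => (i != j) && (F (i, j) || F (j, i)).

Lemma relation_adj_sym F : symmetric (relation_adj F).
Proof. by move=> i j; rewrite /relation_adj eq_sym orbC. Qed.

Lemma relation_adj_irr F : irreflexive (relation_adj F).
Proof. by move=> i; rewrite /relation_adj eqxx. Qed.

Definition relation_graph F : sgraph := SGraph (@relation_adj_sym F) (@relation_adj_irr F).

Lemma relabelling (G : sgraph) : #|G| = n -> exists F, isomorphic G (relation_graph F).
Proof.
move=> card_G; pose f (x : G) := cast_ord card_G (enum_rank x).
pose g i := enum_val (cast_ord (esym card_G) i).
have fK : cancel f g by move=> x; rewrite /f /g cast_ordK enum_rankK.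
have gK : cancel g f by move=> i; rewrite /f /g enum_valK cast_ordKV.
exists [ffun p => adj (g p.1) (g p.2)]; exists f; first exact: Bijective fK gK.
move=> x y; rewrite /= /relation_adj !ffunE /= !fK [adj y x]adj_sym orbb.
rewrite (can_eq fK); case: eqVneq => [->|] //=; by rewrite adj_irr.
Qed.

End Relabelling.

(** Up to isomorphism there are finitely many graphs on [n] vertices. *)
Lemma maximizer_exists (R : realType) (n e : nat) (G : sgraph) :
  graph_class n e G -> exists H, maximizes_spectral_radius R n e H.
Proof.
move=> classG; have relabel H : graph_class n e H ->
    exists2 F : {ffun 'I_n * 'I_n -> bool}, graph_class n e (relation_graph F) &
      spectral_radius R H <= spectral_radius R (relation_graph F).
  move=> classH; have [connH card_H _] := classH.
  have [F isoF] := relabelling card_H.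
  have classF := graph_class_isomorphic isoF classH; exists F => //.
  by have [[F0 _] _ _] := classF; apply: spectral_radius_isomorphic.
have [F0 /asboolP F0P _] := relabel G classG.
have := @Order.TotalTheory.arg_maxP _ _ _ F0
  (fun F => `[< graph_class n e (relation_graph F) >])
  (fun F => spectral_radius R (relation_graph F)) F0P.
case=> F /asboolP classF maxF.
exists (relation_graph F); split=> // H /relabel[F1 /asboolP F1P le_H].
by apply: le_trans le_H _; apply: maxF.
Qed.

Section GraphV.
Variables n e : nat.
Hypothesis n_ge : (e + 2 <= n)%N.

Let v : graphV n e := inr ord0.
Let u : graphV n e := inl (inl (inl ord0)).

Lemma middle_graphV : middle v u = [set inl (inl (inr j)) | j : 'I_e].
Proof.
apply/setP => -[[[w|w]|w]|w]; rewrite !inE /=; apply/esym.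
- by apply/imsetP => -[].
- by apply/imsetP; exists w.
- by apply/imsetP => -[].
- by rewrite andbT [w]ord1 eqxx; apply/imsetP => -[].
Qed.

Lemma graphV_star_hub_pair : star_hub_pair v u.
Proof.
split; first split=> //.
- by move=> [w|w] //; rewrite [w]ord1 eqxx.
- by move=> [[[b|b]|b]|b] [[[w|w]|w]|w] //=; rewrite !ord1 !inE ?eqxx ?orbT.
by move=> b w; rewrite middle_graphV => /imsetP[i _ ->] /imsetP[j _ ->].
Qed.

Lemma card_middle_graphV : #|middle v u| = e.
Proof. by rewrite middle_graphV card_imset ?card_ord // => i j []. Qed.

Lemma card_graphV : #|graphV n e| = n.
Proof. rewrite /= !card_sum !card_ord; move: n_ge; lia. Qed.

Lemma graphV_class : graph_class n e (graphV n e).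
Proof.
have [hubs no_in] := graphV_star_hub_pair.
split; [exact: hub_pair_connected hubs | exact: card_graphV |].
have /eqP := hub_pair_edges rat hubs.
have /eqP -> := introT (inner_volume_eq0 rat v u) no_in.
rewrite addr0 card_graphV card_middle_graphV.
have -> : (n%:R - 1 + e%:R : rat) = (n - 1 + e)%N%:R.
  by rewrite natrD natrB //; move: n_ge; lia.
by rewrite -natrM eqr_nat eqn_pmul2l // => /eqP.
Qed.

End GraphV.

(** If [middle v u] spans an edge, then the radius [L] of [G] satisfies the eigenvalue
    equations of a hub pair with [s > 0]; but [L] is at least the radius of
    [graphV n e], which gives the two hypotheses of [star_dominates] on [L]. *)
Lemma maximizer_isomorphic (R : realType) (e n : nat) (G : sgraph) :
    (130 < e)%N -> (e + 2 <= n)%N -> e%:R + 2 + 13 * Num.sqrt (e%:R : R) <= n%:R ->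
    maximizes_spectral_radius R n e G ->
  isomorphic G (graphV n e).
Proof.
move=> he n_ge hn [[connG card_G edges_G] maxG].
have classV := graphV_class n_ge; have starV := graphV_star_hub_pair n e.
have [connV card_V _] := classV.
have [v [u hubs]] : exists v u : G, hub_pair v u.
  apply: (maximal_hub_pair (R := R)) => //; first by rewrite card_G; lia.
  by move=> H connH card_H edges_H; apply: maxG; split; rewrite ?card_H ?edges_H.
pose d : R := #|middle v u|%:R; pose m := inner_volume R (middle v u) (@adj G).
have [delta deltaE] : exists delta : R, delta = n%:R - e%:R - 2 by eexists.
have card_Z : #|pendant v u|%:R = n%:R - 2 - d :> R.
  by rewrite -card_G (hub_pair_card hubs) !natrD /d; ring.
have m_eq : m = 2 * (e%:R - d).
  have := hub_pair_edges R hubs; rewrite edges_G card_G natrM natrD natrB; last lia.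
  by rewrite -/d -/m; lra.
have card_ZV : #|pendant (inr ord0 : graphV n e) (inl (inl (inl ord0)))|%:R = delta :> R.
  have := hub_pair_card starV.1; rewrite card_V card_middle_graphV //.
  move/(congr1 (fun k => k%:R : R)); rewrite !natrD deltaE.
  by move: #|_|%:R => z; lra.
suff m0 : m = 0.
  apply: (star_hub_pair_isomorphic (v := v) (u := u) _ starV).
  - by split=> //; apply/(inner_volume_eq0 R)/eqP.
  - rewrite card_middle_graphV //; apply/eqP; rewrite -(eqr_nat R) -/d.
    by apply/eqP; lra.
  - by rewrite card_G card_V.
have [] := star_hub_pair_radius R starV connV.
rewrite card_ZV card_middle_graphV //.
set mu := spectral_radius R (graphV n e) => mu0 gap_mu eq_mu.
have le_mu : mu <= spectral_radius R G by apply: maxG.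
have [x x0 xE] := perron R connG.
set L := spectral_radius R G in le_mu xE.
have e0 : 0 <= e%:R :> R by apply: ler0n.
have delta_ge : 13 * Num.sqrt e%:R <= delta by rewrite deltaE; lra.
have delta0 : 0 <= delta by apply: le_trans delta_ge; rewrite mulr_ge0 ?sqrtr_ge0.
have [] := star_radius_mono (c := e%:R + delta) e0 _ mu0 le_mu gap_mu.
- by rewrite lerDl.
- by rewrite opprD addrA.
rewrite opprD addrA => gap_L sq_L.
have L0 : 0 < L := lt_le_trans mu0 le_mu.
apply/eqP; apply: contraT => m_neq0.
have m_ge0 : 0 <= m by apply: sumr_ge0 => b _; apply: inner_degree_ge0.
have s0 : 0 < e%:R - d by move: m_neq0; rewrite neq_lt ltNge m_ge0 /= m_eq; lra.
exfalso; apply: (@star_dominates R e%:R d (e%:R - d) delta L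
  (degree_square_sum R (middle v u) (@adj G)) (x u) (x v)
  (\sum_(b in middle v u) inner_sum (middle v u) (@adj G) x b)) => //.
- by rewrite ler_nat.
- by rewrite addrC subrK.
- by rewrite -m_eq; apply: inner_volume_le; exact: adj_irr.
- rewrite -m_eq; apply: degree_square_sum_le; [exact: adj_sym|exact: adj_irr].
- by apply: sumr_ge0 => b _; apply: sumr_ge0 => w _; apply: ltW.
- rewrite -m_eq; exact: (eigen_middle_bound hubs x0 L0 xE).
- exact: (eigen_second_hub hubs xE).
- rewrite (eigen_first_hub hubs xE) card_Z deltaE -/d.
  by congr (_ + _ * _); ring.
Qed.

Unset Implicit Arguments.

Theorem corollary5p2 (R : realType) (e n : nat) (he : (130 < e)%N)
    (hn : e%:R + 2 + 13 * Num.sqrt (e%:R : R) <= n%:R) :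
  maximizes_spectral_radius R n e (graphV n e) /\
  (forall G : sgraph, maximizes_spectral_radius R n e G ->
     isomorphic G (graphV n e)).
Proof.
have n_ge : (e + 2 <= n)%N.
  rewrite -(ler_nat R) natrD; apply: le_trans hn; rewrite lerDl.
  by rewrite mulr_ge0 ?sqrtr_ge0.
have unique G := @maximizer_isomorphic R e n G he n_ge hn.
split=> //; have classV := graphV_class n_ge.
have [G maxG] := maximizer_exists R classV.
split=> // H classH; have [[connG _ _] max_le] := maxG.
apply: le_trans (max_le H classH) _; apply: spectral_radius_isomorphic => //.
  by have [[]] := classV.
exact: unique.
Qed.
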